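(* Let $d,L,Q\ge1$ be integers, let $c_0,\dots,c_{Q-1}\in\mathbb{R}^d$, and let $A_1,\dots,A_d\in\mathbb{R}^{L\times L}$ be symmetric matrices. Let $\Omega_\zeta\in\mathbb{R}^{L\times L}$, $\zeta=0,\dots,Q-1$, be symmetric positive (possibly only semi-definite) matrices such that $$\sum_{\zeta=0}^{Q-1}\Omega_\zeta=I,\qquad \sum_{\zeta=0}^{Q-1}c_\zeta^a\,\Omega_\zeta=A_a\quad(a=1,\dots,d),$$ and let $\bar f_\zeta(q)=\Omega_\zeta q$ for $q\in\mathbb{R}^L$. Assume $$h_\zeta(f_\zeta)=\tfrac12\sum_{l,m=1}^L f_{\zeta,l}\,[\Omega_\zeta^{-1}]_{lm}\,f_{\zeta,m},$$ where $\Omega_\zeta^{-1}$ denotes the matrix inverse of $\Omega_\zeta$ (the standard inverse if $\Omega_\zeta$ is positive definite, or the generalized inverse, well-defined e.g. by SVD, in the semi-definite case). Let $k>0$ and $t^n=nk$. Then for the kinetic scheme with parameter $\omega$ and time step $k$ it holds, if $\omega=1$, $$\sum_{\zeta=0}^{Q-1}h_\zeta(f_\zeta^{n+1})+\int_{t^n}^{t^{n+1}}\sum_{a=1}^d\partial_a\Big(\sum_{\zeta=0}^{Q-1}c_\zeta^a\,h_\zeta(f_\zeta)\Big)ds\ \le\ \sum_{\zeta=0}^{Q-1}h_\zeta(f_\zeta^n),$$ and, if $\omega=2$, the same relation holds with equality, where $f_\zeta$ is the solution to the transport step from $f_\zeta^{n+\frac12}$ to $f_\zeta^{n+1}$.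
   Context: The unknowns are $f^n=(f^n_\zeta)_{\zeta=0,\dots,Q-1}$, with $f^n_\zeta$ a function of $\boldsymbol{a}\in\mathbb{R}^d$ with values in $\mathbb{R}^L$ (components $f^n_{\zeta,l}$, $l=1,\dots,L$), regular enough for the derivatives in the claim to make sense. One step of the (vectorial) kinetic scheme with parameter $\omega$ and time step $k$ is $$f^{n+1}_{\zeta}(\boldsymbol{a}+kc_\zeta)=(1-\omega)f^n_{\zeta}(\boldsymbol{a})+\omega\,\bar f_{\zeta}\big(M_0f^n(\boldsymbol{a})\big),\qquad M_0f:=\sum_{\zeta=0}^{Q-1}f_\zeta\in\mathbb{R}^L .$$ It splits into a projection step $$f^{n+\frac12}_{\zeta}(\boldsymbol{a})=(1-\omega)f^n_{\zeta}(\boldsymbol{a})+\omega\,\bar f_\zeta\big(M_0f^n(\boldsymbol{a})\big)$$ followed by a transport step: $f_\zeta$ solves $$\partial_tf_\zeta+\sum_{a=1}^dc_\zeta^a\,\partial_af_\zeta=0\ \text{ on }(t^n,t^{n+1})\times\mathbb{R}^d,\qquad f_\zeta(t^n,\cdot)=f_\zeta^{n+\frac12},$$ and $f_\zeta^{n+1}=f_\zeta(t^{n+1},\cdot)$, i.e. $f_\zeta^{n+1}(\boldsymbol{a}+kc_\zeta)=f_\zeta^{n+\frac12}(\boldsymbol{a})$. Here $c_\zeta^a$ is the $a$-th component of $c_\zeta$ and $\partial_a$ is the partial derivative in the $a$-th space coordinate. The scheme targets the linear symmetric-hyperbolic system $\partial_tq+\sum_{a=1}^dA_a\partial_aq=0$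 with unknown $q\in\mathbb{R}^L$. The relation in the claim is understood pointwise in $\boldsymbol{a}$.
   Formalization: When some Ω_ζ is only semi-definite (singular), it is additionally assumed that f^n_ζ(a) lies in the range of Ω_ζ for every a; without this the claim fails (e.g. L=d=1, Q=2, Ω_0=0, Ω_1=1, constant f_0=1, f_1=0). *)

(* Defs.v *)
From HB Require Import structures.
From mathcomp Require Import all_boot all_order all_algebra.
From mathcomp Require Import all_classical all_reals all_analysis.

Set Implicit Arguments.
Unset Strict Implicit.
Unset Printing Implicit Defensive.

Import Order.TTheory GRing.Theory Num.Theory.
Import numFieldNormedType.Exports.

Local Open Scope classical_set_scope.
Local Open Scope ring_scope.

Definition sympos_mx (R : realType) (n : nat) (A : 'M[R]_n) : Prop :=
  A \is symmetricmx /\ forall v : 'cV[R]_n, 0 <= (v^T *m A *m v) 0 0.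

(* Moore-Penrose inverse, through the full-rank factorization
   A = col_base A *m row_base A.  The library's pinvmx is only a partial inverse.
   The lemmas below relate mpinv to the Penrose equations, to invmx and to the
   singular value decomposition. *)
Definition mpinv (R : realType) (n : nat) (A : 'M[R]_n) : 'M[R]_n :=
  (row_base A)^T *m invmx (row_base A *m (row_base A)^T)
  *m invmx ((col_base A)^T *m col_base A) *m (col_base A)^T.

Definition penrose (R : realType) (n : nat) (A X : 'M[R]_n) : Prop :=
  [/\ A *m X *m A = A, X *m A *m X = X,
      (A *m X)^T = A *m X & (X *m A)^T = X *m A].

Lemma mulmx_tr_eq0 (R : realType) (m n : nat) (A : 'M[R]_(m, n)) :
  A *m A^T = 0 -> A = 0.
Proof.
move=> A0; apply/matrixP => i j; rewrite mxE.
have /matrixP/(_ i i) := A0; rewrite !mxE => /psumr_eq0P H.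
apply/eqP; rewrite -sqrf_eq0 expr2.
have /= := H (fun k _ => _) j isT; rewrite mxE => -> // k.
by rewrite mxE -expr2 sqr_ge0.
Qed.

Lemma gram_unit (R : realType) (m n : nat) (A : 'M[R]_(m, n)) :
  row_free A -> A *m A^T \in unitmx.
Proof.
move=> fA; rewrite -row_free_unit -kermx_eq0; apply/eqP.
have K0 : kermx (A *m A^T) *m (A *m A^T) = 0 by exact: mulmx_ker.
have : kermx (A *m A^T) *m A = 0.
  by apply: mulmx_tr_eq0; rewrite trmx_mul mulmxA -(mulmxA _ A) K0 mul0mx.
by rewrite -(mul0mx _ A) => /(row_free_inj fA).
Qed.

Lemma penrose_full_rank (R : realType) (n r : nat)
    (C : 'M[R]_(n, r)) (B : 'M[R]_(r, n)) :
  B *m B^T \in unitmx -> C^T *m C \in unitmx ->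
  penrose (C *m B)
    (B^T *m invmx (B *m B^T) *m invmx (C^T *m C) *m C^T).
Proof.
move=> uB uC.
set G := invmx (B *m B^T); set H := invmx (C^T *m C).
have GT : G^T = G by rewrite /G trmx_inv trmx_mul trmxK.
have HT : H^T = H by rewrite /H trmx_inv trmx_mul trmxK.
have BG : B *m (B^T *m G) = 1%:M by rewrite mulmxA mulmxV.
have HC : H *m (C^T *m C) = 1%:M by rewrite mulVmx.
have AX : C *m B *m (B^T *m G *m H *m C^T) = C *m H *m C^T.
  have -> : B^T *m G *m H *m C^T = B^T *m G *m (H *m C^T) by rewrite !mulmxA.
  by rewrite -(mulmxA C) (mulmxA B) BG mul1mx mulmxA.
have XA : B^T *m G *m H *m C^T *m (C *m B) = B^T *m G *m B.
  by rewrite mulmxA -(mulmxA _ C^T C) -(mulmxA _ H) HC mulmx1.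
split.
- by rewrite AX mulmxA -(mulmxA _ C^T C) -(mulmxA _ H) HC mulmx1.
- have -> : B^T *m G *m H *m C^T = B^T *m G *m (H *m C^T) by rewrite !mulmxA.
  rewrite {1}(mulmxA _ H) XA -(mulmxA _ B) (mulmxA B (B^T *m G)) BG mul1mx.
  by rewrite !mulmxA.
- by rewrite AX !trmx_mul trmxK HT mulmxA.
- by rewrite XA !trmx_mul trmxK GT mulmxA.
Qed.

Lemma mpinvP (R : realType) (n : nat) (A : 'M[R]_n) : penrose A (mpinv A).
Proof.
have uC : (col_base A)^T *m col_base A \in unitmx.
  have := @gram_unit R _ _ (col_base A)^T; rewrite trmxK; apply.
  by rewrite /row_free mxrank_tr; exact: col_base_full.
have := penrose_full_rank (gram_unit (row_base_free A)) uC.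
by rewrite mulmx_base.
Qed.

Lemma penrose_uniq (R : realType) (n : nat) (A X Y : 'M[R]_n) :
  penrose A X -> penrose A Y -> X = Y.
Proof.
move=> [X1 X2 X3 X4] [Y1 Y2 Y3 Y4].
have AXY : A *m X = A *m Y.
  by rewrite -[LHS]X3 -{1}Y1 -(mulmxA _ A X) trmx_mul X3 Y3 mulmxA X1.
have XYA : X *m A = Y *m A.
  by rewrite -[LHS]X4 -{1}Y1 -(mulmxA A) mulmxA trmx_mul X4 Y4 -mulmxA (mulmxA A) X1.
by rewrite -X2 XYA -mulmxA AXY mulmxA.
Qed.

Lemma mpinv_unit (R : realType) (n : nat) (A : 'M[R]_n) :
  A \in unitmx -> mpinv A = invmx A.
Proof.
move=> uA; apply: (penrose_uniq (mpinvP A)).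
by split; rewrite ?mulmxV ?mulVmx ?mul1mx ?trmx1.
Qed.

Lemma mpinv_svd (R : realType) (n : nat) (U V : 'M[R]_n) (s : 'rV[R]_n) :
  U^T *m U = 1%:M -> V^T *m V = 1%:M ->
  mpinv (U *m diag_mx s *m V^T) = V *m diag_mx (map_mx GRing.inv s) *m U^T.
Proof.
move=> UU VV; apply: (penrose_uniq (mpinvP _)).
set D := diag_mx s; set E := diag_mx _.
have E1 : (U *m D *m V^T) *m (V *m E *m U^T) = U *m (D *m E) *m U^T.
  by rewrite !mulmxA -(mulmxA _ V^T V) VV mulmx1.
have E2 : (V *m E *m U^T) *m (U *m D *m V^T) = V *m (E *m D) *m V^T.
  by rewrite !mulmxA -(mulmxA _ U^T U) UU mulmx1.
have ED : E *m D = D *m E by exact: diag_mxC.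
have DED : D *m E *m D = D.
  rewrite /D /E !mulmx_diag; congr diag_mx; apply/rowP => i; rewrite !mxE.
  by have [->|s0] := eqVneq (s 0 i) 0; rewrite ?mulr0 // mulfV // mul1r.
have EDE : E *m D *m E = E.
  rewrite /D /E !mulmx_diag; congr diag_mx; apply/rowP => i; rewrite !mxE.
  by have [->|s0] := eqVneq (s 0 i) 0; rewrite ?invr0 ?mulr0 // mulVf // mul1r.
have DET : (D *m E)^T = D *m E by rewrite trmx_mul !tr_diag_mx.
split.
- by rewrite E1 !mulmxA -(mulmxA _ U^T U) UU mulmx1 -(mulmxA U) -(mulmxA U) DED.
- by rewrite E2 !mulmxA -(mulmxA _ V^T V) VV mulmx1 -(mulmxA V) -(mulmxA V) EDE.
- by rewrite E1 !trmx_mul trmxK -trmx_mul DET -mulmxA.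
- by rewrite E2 ED !trmx_mul trmxK -trmx_mul DET -mulmxA.
Qed.

Definition kinetic_entropy (R : realType) (L : nat) (Omega : 'M[R]_L)
    (f : 'cV[R]_L) : R :=
  1 / 2 * \sum_(l < L) \sum_(m < L) f l 0 * mpinv Omega l m * f m 0.

(* For singular Omega the generalized inverse kills the orthogonal complement of
   the range of Omega, so kinetic_entropy is the convex entropy dual to
   q |-> 1/2 q^T Omega q only on that range (the dual is infinite elsewhere).
   The range is preserved by the projection and transport steps.  The condition
   is void for positive definite Omega. *)
Definition entropy_domain (R : realType) (d L Q : nat)
    (Omega : 'I_Q -> 'M[R]_L) (f : 'I_Q -> 'rV[R]_d -> 'cV[R]_L) : Prop :=
  forall z, Omega z \notin unitmx ->
  forall x, exists v : 'cV[R]_L, f z x = Omega z *m v.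

Definition partial (R : realType) (d : nat) (W : normedModType R) (a : 'I_d)
    (g : 'rV[R]_d -> W) (x : 'rV[R]_d) : W :=
  'D_(delta_mx 0 a) g x.

Definition cont_diff (R : realType) (d : nat) (W : normedModType R)
    (g : 'rV[R]_d -> W) : Prop :=
  (forall x, differentiable g x) /\ forall a : 'I_d, continuous (partial a g).

Definition projection_step (R : realType) (d L Q : nat)
    (Omega : 'I_Q -> 'M[R]_L) (omega : R)
    (f : 'I_Q -> 'rV[R]_d -> 'cV[R]_L) : 'I_Q -> 'rV[R]_d -> 'cV[R]_L :=
  fun z x => (1 - omega) *: f z x + omega *: (Omega z *m \sum_(y < Q) f y x).

Definition kinetic_step (R : realType) (d L Q : nat)
    (c : 'I_Q -> 'rV[R]_d) (Omega : 'I_Q -> 'M[R]_L) (omega k : R)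
    (f f' : 'I_Q -> 'rV[R]_d -> 'cV[R]_L) : Prop :=
  forall z x, f' z (x + k *: c z) = projection_step Omega omega f z x.

(* Classical solution on the time slab from t0 to t1: only the values F z t x
   with t0 <= t <= t1 matter.  Joint differentiability in (t, x) is what gives
   the equation its meaning along characteristics, and continuity up to t0 and
   t1 ties the solution to its initial and final data. *)
Definition transport_step (R : realType) (d L Q : nat)
    (c : 'I_Q -> 'rV[R]_d) (t0 t1 : R)
    (g : 'I_Q -> 'rV[R]_d -> 'cV[R]_L)
    (F : 'I_Q -> R -> 'rV[R]_d -> 'cV[R]_L)
    (g' : 'I_Q -> 'rV[R]_d -> 'cV[R]_L) : Prop :=
  forall z,
  [/\ {within [set p : R * 'rV[R]_d | t0 <= p.1 <= t1],
        continuous (fun p : R * 'rV[R]_d => F z p.1 p.2)},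
      forall t x, t0 < t < t1 ->
        differentiable (fun p : R * 'rV[R]_d => F z p.1 p.2) (t, x) /\
        derive1 (fun s => F z s x) t
          + \sum_(a < d) c z 0 a *: partial a (F z t) x = 0,
      F z t0 = g z & F z t1 = g' z].

(* Main.v *)
(* Along the characteristics of the transport step F is constant, so
   F z s y = g z (y - (s - t0) c_z) with g the projected state.  The flux term is
   therefore minus the time derivative of s |-> sum_z h_z(g z (x - (s - t0) c_z)),
   and the fundamental theorem of calculus turns the left-hand side into
   sum_z h_z(g z x).  It remains to compare g with f pointwise: writing
   f z = Omega_z v_z and q = sum_z f z, one has
   g z = Omega_z (omega q + (1 - omega) v_z), and the quadratic form
   sum_z u_z^T Omega_z u_z / 2 at these arguments is computed from
   sum_z Omega_z = 1. *)
Require Import Defs.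
From HB Require Import structures.
From mathcomp Require Import all_boot all_order all_algebra.
From mathcomp Require Import all_classical all_reals all_analysis.
From mathcomp Require Import lra ring.
Import Order.TTheory GRing.Theory Num.Theory.
Import numFieldNormedType.Exports.
Set Implicit Arguments.
Unset Strict Implicit.
Local Open Scope classical_set_scope.
Local Open Scope ring_scope.

(** * Kinetic entropy as a quadratic form *)

Lemma kinetic_entropyE (R : realType) (L : nat) (Omega : 'M[R]_L)
    (f : 'cV[R]_L) :
  kinetic_entropy Omega f = 1 / 2 * (f^T *m mpinv Omega *m f) 0 0.
Proof.
congr (_ * _); rewrite !mxE exchange_big /=; apply: eq_bigr => m _.
by rewrite !mxE mulr_suml; apply: eq_bigr => l _; rewrite !mxE.
Qed.

(** The Penrose identity [A *m X *m A = A] absorbs the generalized inverse on the range of [Omega],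
    so definite and semi-definite matrices are handled alike from here on. *)
Lemma kinetic_entropy_mulmx (R : realType) (L : nat) (Omega : 'M[R]_L)
    (v : 'cV[R]_L) : Omega^T = Omega ->
  kinetic_entropy Omega (Omega *m v) = 1 / 2 * (v^T *m Omega *m v) 0 0.
Proof.
move=> symO; have [OXO _ _ _] := mpinvP Omega.
by rewrite kinetic_entropyE trmx_mul symO -[in RHS]OXO !mulmxA.
Qed.

Lemma sympos_tr (R : realType) (n : nat) (A : 'M[R]_n) :
  sympos_mx A -> A^T = A.
Proof.
by case=> + _; rewrite qualifE /= => /eqP {2}->; rewrite expr0 scale1r map_mx_id.
Qed.

(** * Entropy of combinations of the equilibrium with the current state *)

Section projection_entropy.
Context {R : realType} {L Q : nat}.
Variables (Omega : 'I_Q -> 'M[R]_L) (v : 'I_Q -> 'cV[R]_L).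
Hypothesis Omega_sum : \sum_(z < Q) Omega z = 1%:M.
Hypothesis Omega_pos : forall z, sympos_mx (Omega z).

Let q := \sum_(z < Q) Omega z *m v z.
Let qf (M : 'M[R]_L) (u w : 'cV[R]_L) := (u^T *m M *m w) 0 0.

Let qfC z u w : qf (Omega z) u w = qf (Omega z) w u.
Proof.
have trC (x : 'M[R]_1) : x 0 0 = x^T 0 0 by rewrite mxE.
by rewrite /qf [LHS]trC !trmx_mul trmxK (sympos_tr (Omega_pos z)) mulmxA.
Qed.

Let qf_comb z (a b : R) u w : qf (Omega z) (a *: u + b *: w) (a *: u + b *: w) =
  a ^+ 2 * qf (Omega z) u u + 2 * a * b * qf (Omega z) u w
  + b ^+ 2 * qf (Omega z) w w.
Proof.
have E : (qf (Omega z) (a *: u + b *: w) (a *: u + b *: w) =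
  a ^+ 2 * qf (Omega z) u u + a * b * qf (Omega z) u w
  + b * a * qf (Omega z) w u + b ^+ 2 * qf (Omega z) w w).
  rewrite /qf; have -> : (a *: u + b *: w)^T = a *: u^T + b *: w^T.
    by apply/matrixP => i j; rewrite !mxE.
  rewrite !mulmxDl !mulmxDr -!scalemxAl -!scalemxAr.
  by rewrite !scalerA !mxE; ring.
by rewrite E (qfC z w); ring.
Qed.

Let sum_qf_cross : \sum_z qf (Omega z) q (v z) = (q^T *m q) 0 0.
Proof.
by rewrite {3}/q mulmx_sumr summxE; apply: eq_bigr => z _; rewrite /qf mulmxA.
Qed.

Let sum_qf_diag : \sum_z qf (Omega z) q q = (q^T *m q) 0 0.
Proof.
have -> : q^T *m q = \sum_z q^T *m (Omega z *m q).
  by rewrite -mulmx_sumr -mulmx_suml Omega_sum mul1mx.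
by rewrite summxE; apply: eq_bigr => z _; rewrite /qf mulmxA.
Qed.

(** After expanding the square, the cross terms add up to [q^T *m q] by the definition of [q], and
    the pure [q] terms add up to the same value because the [Omega z] sum to the identity. *)
Let sum_qf (a b : R) :
  \sum_z qf (Omega z) (a *: q + b *: v z) (a *: q + b *: v z) =
  (a ^+ 2 + 2 * a * b) * (q^T *m q) 0 0
  + b ^+ 2 * \sum_z qf (Omega z) (v z) (v z).
Proof.
under eq_bigr do rewrite qf_comb.
by rewrite !big_split /= -!mulr_sumr sum_qf_cross sum_qf_diag; ring.
Qed.

(** With [a = omega] and [b = 1 - omega] the left-hand side is the entropy after the projection
    step; with [a = 1] and [b = -1] it measures the distance to equilibrium. *)
Lemma sum_kinetic_entropy_comb (a b : R) :
  \sum_z kinetic_entropy (Omega z) (Omega z *m (a *: q + b *: v z)) =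
  (a ^+ 2 + 2 * a * b) * (1 / 2 * (q^T *m q) 0 0)
  + b ^+ 2 * \sum_z kinetic_entropy (Omega z) (Omega z *m v z).
Proof.
have E u : \sum_z kinetic_entropy (Omega z) (Omega z *m u z) =
    1 / 2 * \sum_z qf (Omega z) (u z) (u z).
  rewrite mulr_sumr; apply: eq_bigr => z _.
  exact/kinetic_entropy_mulmx/sympos_tr.
by rewrite !E sum_qf; ring.
Qed.

(* The difference of the two sides is half the sum of
   [(q - v z)^T *m Omega z *m (q - v z)]. *)
Lemma sum_kinetic_entropy_ge :
  1 / 2 * (q^T *m q) 0 0 <= \sum_z kinetic_entropy (Omega z) (Omega z *m v z).
Proof.
have := sum_kinetic_entropy_comb 1 (-1).
set S := \sum_z _ => E; suff : 0 <= S by rewrite E; lra.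
apply: sumr_ge0 => z _; rewrite kinetic_entropy_mulmx; last exact: sympos_tr.
by apply: mulr_ge0; [rewrite divr_ge0|apply: (Omega_pos z).2].
Qed.

End projection_entropy.

(** * Directional derivatives under affine changes of variable *)

Section affine.
Context {R : realType} {U V W : normedModType R}.
Variables (f : V -> W) (l : U -> V) (x v : U) (w : V).
Hypothesis lE : forall h : R, l (h *: v + x) = h *: w + l x.

Let quotE : (fun h : R => h^-1 *: (((f \o l) \o shift x) (h *: v) - (f \o l) x)) =
  (fun h : R => h^-1 *: ((f \o shift (l x)) (h *: w) - f (l x))).
Proof. by apply/funext => h /=; rewrite lE. Qed.

(** [l] carries the line through [x] along [v] to the line through [l x] along [w] with the same
    parameter, so both difference quotients are one function of [h]. *)
Lemma derive_comp_affine : 'D_v (f \o l) x = 'D_w f (l x).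
Proof. by rewrite /derive quotE. Qed.

Lemma derivable_comp_affine : derivable f (l x) w -> derivable (f \o l) x v.
Proof. by rewrite /derivable quotE. Qed.

End affine.

(** Turns the advection operator, a combination of partial derivatives with the components of the
    velocity as weights, into one directional derivative. *)
Lemma derive_partial (R : realType) (d : nat) (W : normedModType R)
    (h : 'rV[R]_d -> W) (v x : 'rV[R]_d) : differentiable h x ->
  'D_v h x = \sum_(a < d) v 0 a *: partial a h x.
Proof.
move=> dh; rewrite deriveE // {1}(row_sum_delta v) linear_sum.
by apply: eq_bigr => a _; rewrite linearZ /partial deriveE.
Qed.

Lemma derive_dirD (R : realType) (V W : normedModType R) (f : V -> W)
    (x u v : V) : differentiable f x -> 'D_(u + v) f x = 'D_u f x + 'D_v f x.
Proof. by move=> df; rewrite !deriveE // linearD. Qed.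

Lemma derive_dirN (R : realType) (V W : normedModType R) (f : V -> W)
    (x u : V) : differentiable f x -> 'D_(- u) f x = - 'D_u f x.
Proof. by move=> df; rewrite !deriveE // linearN. Qed.

(** * Closure properties of continuously differentiable functions *)

Section cont_diff_closure.
Context {R : realType} {d : nat}.
Implicit Types g h : 'rV[R]_d -> R.

Lemma cont_diff_cst (r : R) : cont_diff (fun _ : 'rV[R]_d => r).
Proof.
split=> [x|a]; first exact: differentiable_cst.
rewrite (_ : partial a _ = cst 0); first exact: cst_continuous.
by apply/funext => x; rewrite /partial derive_cst.
Qed.

Lemma cont_diffD g h : cont_diff g -> cont_diff h ->
  cont_diff (fun x => g x + h x).
Proof.
move=> [dg cg] [dh ch]; split=> [x|a]; first exact: differentiableD.
rewrite (_ : partial a _ = partial a g + partial a h).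
  by move=> x; exact: (cvgD (cg a x) (ch a x)).
by apply/funext => x; rewrite /partial deriveD //; exact: diff_derivable.
Qed.

Lemma cont_diffM g h : cont_diff g -> cont_diff h ->
  cont_diff (fun x => g x * h x).
Proof.
move=> [dg cg] [dh ch]; split=> [x|a]; first exact: differentiableM.
rewrite (_ : partial a _ = (fun x => g x * partial a h x + h x * partial a g x)).
  move=> x; have cvg_diff (u : 'rV[R]_d -> R) : (forall x, differentiable u x) ->
      u @ x --> u x by move=> /(_ x)/differentiable_continuous.
  exact: (cvgD (cvgM (cvg_diff _ dg) (ch a x)) (cvgM (cvg_diff _ dh) (cg a x))).
by apply/funext => x; rewrite /partial deriveM //; exact: diff_derivable.
Qed.

Lemma cont_diff_sum (I : Type) (r : seq I) (h : I -> 'rV[R]_d -> R) :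
  (forall i, cont_diff (h i)) -> cont_diff (fun x => \sum_(i <- r) h i x).
Proof.
move=> hC1; elim: r => [|i r IHr].
  by under eq_fun do rewrite big_nil; exact: cont_diff_cst.
by under eq_fun do rewrite big_cons; exact: cont_diffD.
Qed.

Lemma cont_diff_coord (m n : nat) (g : 'rV[R]_d -> 'M[R]_(m, n)) i j :
  cont_diff g -> cont_diff (fun x => g x i j : R).
Proof.
move=> [dg cg]; split=> [x|a].
  apply: (@differentiable_comp _ _ _ _ g (fun M : 'M[R]_(m, n) => M i j : R)) => //.
  exact: differentiable_coord.
rewrite (_ : partial a _ = (fun x => partial a g x i j)).
  move=> x; exact: (continuous_comp (cg a x) (@coord_continuous R m n i j _)).
apply/funext => x; rewrite /partial [in RHS]derive_mx ?mxE //.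
exact: diff_derivable.
Qed.

(** The entropy is a polynomial in the coordinates of [g x], so sums and products suffice. *)
Lemma cont_diff_kinetic_entropy (L : nat) (Omega : 'M[R]_L)
    (g : 'rV[R]_d -> 'cV[R]_L) : (forall l, cont_diff (fun x => g x l 0)) ->
  cont_diff (fun x => kinetic_entropy Omega (g x)).
Proof.
move=> gC1; apply: cont_diffM; first exact: cont_diff_cst.
apply: cont_diff_sum => l; apply: cont_diff_sum => m.
apply: cont_diffM => //; apply: cont_diffM => //; exact: cont_diff_cst.
Qed.

(** Supplies the continuity of the integrand that the fundamental theorem of calculus asks for. *)
Lemma cont_diff_derive g (v : 'rV[R]_d) : cont_diff g -> continuous ('D_v g).
Proof.
move=> [dg cg]; have -> : 'D_v g = fun x => \sum_(a < d) v 0 a *: partial a g x.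
  by apply/funext => x; exact: derive_partial.
apply: (@continuous_big _ _ _ _ xpredT add_continuous) => a _ x.
exact: (cvgM (cvg_cst (v 0 a)) (cg a x)).
Qed.

End cont_diff_closure.

(** * Solution of the transport step along characteristics *)

Section transport_characteristic.
Context {R : realType} {d L Q : nat}.
Variables (c : 'I_Q -> 'rV[R]_d) (t0 t1 : R).
Variables (g g' : 'I_Q -> 'rV[R]_d -> 'cV[R]_L).
Variable F : 'I_Q -> R -> 'rV[R]_d -> 'cV[R]_L.
Hypothesis F_transport : transport_step c t0 t1 g F g'.

Lemma transport_step_characteristic z s y : t0 <= s <= t1 ->
  F z s y = g z (y - (s - t0) *: c z).
Proof.
move=> /andP[t0s st1]; have [Fcont Feq <- _] := F_transport z.
have [->|t0_neq] := eqVneq s t0; first by rewrite subrr scale0r subr0.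
have {t0s t0_neq} t0s : t0 < s by rewrite lt_neqAle eq_sym t0_neq.
pose F2 (p : R * 'rV[R]_d) := F z p.1 p.2.
(* The characteristic through [(s, y)], parametrized by time: it passes through [y] at [u = s], and
   its foot at [u = t0] is [y - (s - t0) *: c z]. *)
pose l (u : R) : R * 'rV[R]_d := (u, y + (u - s) *: c z).
have dl u (h : R) : l (h *: (1 : R) + u) = h *: ((1, c z) : R * 'rV[R]_d) + l u.
  rewrite /l; congr (_, _) => /=.
  by rewrite [h *: 1]mulr1 -addrA scalerDl addrCA.
(* The derivative along [l] is the one in direction [(1, c z)]. Joint differentiability splits it
   into a time part and a space part, whose sum is the left-hand side of the transport equation. *)
have dF2 u : t0 < u < t1 -> is_derive u 1 (F2 \o l) 0.
  move=> u01; have [/= dF eF] := Feq u (l u).2 u01.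
  apply: DeriveDef; first exact/(derivable_comp_affine (dl u))/diff_derivable.
  rewrite (derive_comp_affine F2 (dl u)) -eF.
  have -> : ((1, c z) : R * 'rV[R]_d) = (1, 0) + (0, c z).
    by congr (_, _) => /=; rewrite ?addr0 ?add0r.
  have eq1 : 'D_(1, 0) F2 (l u) = derive1 (fun s => F z s (l u).2) u.
    rewrite derive1E; symmetry.
    apply: (derive_comp_affine F2 (l := fun s : R => (s, (l u).2))) => h.
    by congr (_, _); rewrite /= scaler0 add0r.
  have eq2 (v : 'rV[R]_d) : 'D_(0, v) F2 (l u) = 'D_v (F z u) (l u).2.
    symmetry; apply: (derive_comp_affine F2 (l := fun x : 'rV[R]_d => (u, x))) => h.
    by congr (_, _); rewrite /= scaler0 add0r.
  have dFu : differentiable (F z u) (l u).2.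
    by apply: (@differentiable_comp _ _ _ _ (fun x => (u, x)) F2).
  rewrite -(derive_partial _ dFu) -eq2 -eq1.
  exact: derive_dirD.
have lcont : continuous l.
  have l2cont : continuous (fun u : R => y + (u - s) *: c z).
    move=> u; apply: cvgD; first exact: cvg_cst.
    apply: cvgZr_tmp; exact: (cvgB cvg_id (cvg_cst s)).
  move=> u; exact: (cvg_pair cvg_id (l2cont u)).
(* The equation holds only for times strictly inside the slab; the endpoints of [[t0, s]] are
   reached by restricting the continuity on the closed slab to the characteristic. *)
have Gcont : {within `[t0, s], continuous (F2 \o l)}.
  apply/subspace_continuousP => u /= uts.
  have u01 : t0 <= u <= t1.
    by move: uts; rewrite in_itv /= => /andP[-> /le_trans]; exact.
  move/subspace_continuousP/(_ (l u) u01) : Fcont; apply: cvg_comp => B BF.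
  have nearB : \forall v \near u, t0 <= v <= t1 -> B (l v) := lcont u _ BF.
  suff : \forall v \near u, v \in `[t0, s] -> B (l v) by [].
  apply: filterS nearB => v /= + vts; apply.
  by move: vts; rewrite in_itv /= => /andP[-> /le_trans]; exact.
suff : F2 (l s) = F2 (l t0).
  by rewrite /F2 /l /= subrr scale0r addr0 -(opprB s t0) scaleNr.
(* The mean value theorem concerns real-valued functions, hence the passage to entries. *)
apply/matrixP => i j.
have dG u : u \in `]t0, s[ ->
    is_derive u 1 (fun u => (F2 \o l) u i j : R) (cst 0 u).
  rewrite in_itv /= => /andP[t0u us].
  have [dG0 eG0] := dF2 u (andb_true_intro (conj t0u (lt_le_trans us st1))).
  apply: DeriveDef; first exact: (derivable_mxP _ _ _).1.
  by move: eG0; rewrite derive_mx // => /matrixP/(_ i j); rewrite !mxE.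
have Gij : {within `[t0, s], continuous (fun u => (F2 \o l) u i j : R)}.
  move=> u; exact: (continuous_comp (Gcont u) (@coord_continuous R L 1 i j _)).
have [u _ /eqP] := MVT t0s dG Gij.
by rewrite mul0r subr_eq0 => /eqP.
Qed.

End transport_characteristic.

(** * Time integral of the flux divergence of advected functions *)

Section advected_C1.
Context {R : realType} {d : nat}.
Variables (phi : 'rV[R]_d -> R) (c x : 'rV[R]_d) (t0 : R).
Hypothesis phiC1 : cont_diff phi.

Lemma continuous_backward_path :
  continuous (fun s : R => x - (s - t0) *: c).
Proof.
move=> s; apply: (cvgB (cvg_cst x)).
by apply: cvgZr_tmp; exact: (cvgB cvg_id (cvg_cst t0)).
Qed.

Lemma is_derive_advected (s : R) : is_derive s (1 : R)
  (fun s : R => phi (x - (s - t0) *: c)) (- 'D_c phi (x - (s - t0) *: c)).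
Proof.
have lE (h : R) : x - (h *: (1 : R) + s - t0) *: c =
    h *: (- c) + (x - (s - t0) *: c).
  by rewrite [h *: 1]mulr1 -addrA scalerDl opprD scalerN addrCA.
have := derive_comp_affine phi (l := fun s : R => x - (s - t0) *: c) lE.
rewrite derive_dirN; last exact: phiC1.1.
move=> <-; apply: DeriveDef => //.
apply: (derivable_comp_affine (l := fun s : R => x - (s - t0) *: c) lE).
exact/diff_derivable/phiC1.1.
Qed.

End advected_C1.

Section entropy_balance.
Context {R : realType} {d Q : nat}.
Variables (phi : 'I_Q -> 'rV[R]_d -> R) (c : 'I_Q -> 'rV[R]_d) (t0 t1 : R).
Hypothesis phiC1 : forall z, cont_diff (phi z).

(** Partial derivatives commute with the translation by [(s - t0) *: c z]; exchanging the two sums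
    then collects, for each [z], the derivative along [c z]. *)
Lemma divergence_advected (s : R) x :
  \sum_(a < d) partial a (fun y => \sum_(z < Q)
     c z 0 a * phi z (y - (s - t0) *: c z) : R) x =
  \sum_(z < Q) 'D_(c z) (phi z) (x - (s - t0) *: c z).
Proof.
under [RHS]eq_bigr => z _ do rewrite (derive_partial _ ((phiC1 z).1 _)).
rewrite exchange_big /=; apply: eq_bigr => a _; apply: derive_val.
rewrite (_ : (fun y => _) = \sum_(z < Q)
    (c z 0 a *: (phi z \o (fun y => y - (s - t0) *: c z)))); last first.
  by apply/funext => y; rewrite fct_sumE.
apply: is_derive_sum => z; apply: is_deriveZ.
have lE (h : R) : (h *: delta_mx 0 a + x) - (s - t0) *: c z =
  h *: delta_mx 0 a + (x - (s - t0) *: c z) by rewrite addrA.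
rewrite /partial -(derive_comp_affine _ (l := fun y => y - (s - t0) *: c z) lE).
apply: DeriveDef => //.
apply: (derivable_comp_affine (l := fun y => y - (s - t0) *: c z) lE).
exact/diff_derivable/(phiC1 z).1.
Qed.

Lemma integral_divergence_advected x : t0 < t1 ->
  \int[lebesgue_measure]_(s in `[t0, t1])
    \sum_(z < Q) 'D_(c z) (phi z) (x - (s - t0) *: c z) =
  \sum_(z < Q) phi z x - \sum_(z < Q) phi z (x - (t1 - t0) *: c z).
Proof.
(* The primitive carries a minus sign because the backward path moves with velocity [- c z]. *)
move=> t01; pose P (s : R) := - \sum_(z < Q) phi z (x - (s - t0) *: c z).
have dP (s : R) : is_derive s 1 P (\sum_(z < Q) 'D_(c z) (phi z) (x - (s - t0) *: c z)).
  rewrite (_ : P = - \sum_(z < Q) (fun s => phi z (x - (s - t0) *: c z))).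
    apply: is_derive_eq.
      apply: is_deriveN; apply: is_derive_sum => z; exact: is_derive_advected.
    by rewrite sumrN opprK.
  by apply/funext => u; rewrite /P /= fct_sumE.
have Pcont : continuous P.
  by move=> s; apply/differentiable_continuous/derivable1_diffP; case: (dP s).
rewrite /Rintegral (@continuous_FTC2 _ _ P) //.
- rewrite /P /= subrr opprK addrC; congr (_ - _).
  by apply: eq_bigr => z _; rewrite scale0r subr0.
- apply: continuous_subspaceT.
  apply: (@continuous_big _ _ _ _ xpredT add_continuous) => z _ s.
  exact: (continuous_comp (@continuous_backward_path _ _ (c z) x t0 s)
    (@cont_diff_derive _ _ _ (c z) (phiC1 z) _)).
- split.
  + by move=> s _; case: (dP s).
  + exact: (cvg_at_right_filter (Pcont t0)).
  + exact: (cvg_at_left_filter (Pcont t1)).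
- by move=> s _; rewrite derive1E; apply: derive_val.
Qed.

End entropy_balance.

(** * Entropy balance of projection and transport together *)

Lemma cont_diff_projection_step_coord (R : realType) (d L Q : nat)
    (Omega : 'I_Q -> 'M[R]_L) (omega : R)
    (f : 'I_Q -> 'rV[R]_d -> 'cV[R]_L) z l :
  (forall z, cont_diff (f z)) ->
  cont_diff (fun x => projection_step Omega omega f z x l 0 : R).
Proof.
move=> fC1; have -> : (fun x => projection_step Omega omega f z x l 0) =
    (fun x => (1 - omega) * f z x l 0 +
       omega * \sum_m Omega z l m * \sum_y f y x m 0).
  apply/funext => x; rewrite /projection_step !mxE; congr (_ + _ * _).
  by apply: eq_bigr => m _; rewrite summxE.
apply: cont_diffD; apply: cont_diffM; [exact: cont_diff_cst| |exact: cont_diff_cst|].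
  exact: cont_diff_coord.
apply: cont_diff_sum => m; apply: cont_diffM; first exact: cont_diff_cst.
by apply: cont_diff_sum => y; exact: cont_diff_coord.
Qed.

(** Transport conserves entropy whatever the initial data [g]: the final state and the flux are both
    expressed through [g] along characteristics, and the integrated flux is exactly the entropy lost
    at [x]. *)
Lemma entropy_transport_balance (R : realType) (d L Q : nat)
    (Omega : 'I_Q -> 'M[R]_L) (c : 'I_Q -> 'rV[R]_d) (t0 t1 : R)
    (g g' : 'I_Q -> 'rV[R]_d -> 'cV[R]_L)
    (F : 'I_Q -> R -> 'rV[R]_d -> 'cV[R]_L) (x : 'rV[R]_d) :
  t0 < t1 -> (forall z l, cont_diff (fun x => g z x l 0 : R)) ->
  transport_step c t0 t1 g F g' ->
  \sum_(z < Q) kinetic_entropy (Omega z) (g' z x)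
  + \int[lebesgue_measure]_(s in `[t0, t1])
      \sum_(a < d) partial a (fun y => \sum_(z < Q)
         c z 0 a * kinetic_entropy (Omega z) (F z s y) : R) x
  = \sum_(z < Q) kinetic_entropy (Omega z) (g z x).
Proof.
move=> t01 gC1 FT; pose phi z y := kinetic_entropy (Omega z) (g z y).
have phiC1 z : cont_diff (phi z) by apply: cont_diff_kinetic_entropy; exact: gC1.
have -> : \sum_(z < Q) kinetic_entropy (Omega z) (g' z x) =
    \sum_(z < Q) phi z (x - (t1 - t0) *: c z).
  apply: eq_bigr => z _; have [_ _ _ <-] := FT z.
  by rewrite (transport_step_characteristic FT) // lexx (ltW t01).
rewrite [X in _ + X](_ : _ = \int[lebesgue_measure]_(s in `[t0, t1])
    \sum_(z < Q) 'D_(c z) (phi z) (x - (s - t0) *: c z)); last first.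
  (* The characteristic formula is available only for times in the closed slab, so the integrand is
     rewritten under membership in the interval. *)
  apply: eq_Rintegral => s; rewrite inE /= in_itv /= => s01.
  rewrite -divergence_advected //; apply: eq_bigr => a _.
  congr (partial a _ x); apply/funext => y; apply: eq_bigr => z _.
  by rewrite (transport_step_characteristic FT).
by rewrite integral_divergence_advected // addrC subrK.
Qed.

(** For invertible [Omega z] the preimage comes from the inverse; in the singular case it is the
    domain condition. Choice gathers the preimages into one family. *)
Lemma entropy_domain_range (R : realType) (d L Q : nat)
    (Omega : 'I_Q -> 'M[R]_L) (f : 'I_Q -> 'rV[R]_d -> 'cV[R]_L) x :
  entropy_domain Omega f ->
  exists v : 'I_Q -> 'cV[R]_L, forall z, f z x = Omega z *m v z.
Proof.
move=> fdom.
have : forall z, exists u : 'cV[R]_L, f z x = Omega z *m u.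
  move=> z; have [uO|/fdom] := boolP (Omega z \in unitmx); last exact.
  by exists (invmx (Omega z) *m f z x); rewrite mulKVmx.
by move=> /boolp.choice[v fv]; exists v.
Qed.

Unset Implicit Arguments.

Theorem proposition3 (R : realType) (d L Q : nat)
  (d_gt0 : (0 < d)%N) (L_gt0 : (0 < L)%N) (Q_gt0 : (0 < Q)%N)
  (c : 'I_Q -> 'rV[R]_d) (A : 'I_d -> 'M[R]_L)
  (A_sym : forall a, A a \is symmetricmx)
  (Omega : 'I_Q -> 'M[R]_L)
  (Omega_pos : forall z, sympos_mx (Omega z))
  (Omega_sum : \sum_(z < Q) Omega z = 1%:M)
  (Omega_flux : forall a, \sum_(z < Q) c z 0 a *: Omega z = A a)
  (omega k : R) (k_gt0 : 0 < k) (n : nat)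
  (f : nat -> 'I_Q -> 'rV[R]_d -> 'cV[R]_L)
  (f_C1 : forall z, cont_diff (f n z))
  (f_domain : entropy_domain Omega (f n))
  (f_scheme : kinetic_step c Omega omega k (f n) (f n.+1))
  (F : 'I_Q -> R -> 'rV[R]_d -> 'cV[R]_L)
  (F_transport : transport_step c (n%:R * k) (n.+1%:R * k)
     (projection_step Omega omega (f n)) F (f n.+1)) :
  (omega = 1 -> forall x : 'rV[R]_d,
     \sum_(z < Q) kinetic_entropy (Omega z) (f n.+1 z x)
     + \int[lebesgue_measure]_(s in `[n%:R * k, n.+1%:R * k])
         \sum_(a < d) partial a (fun y => \sum_(z < Q)
            c z 0 a * kinetic_entropy (Omega z) (F z s y) : R) x
     <= \sum_(z < Q) kinetic_entropy (Omega z) (f n z x)) /\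
  (omega = 2 -> forall x : 'rV[R]_d,
     \sum_(z < Q) kinetic_entropy (Omega z) (f n.+1 z x)
     + \int[lebesgue_measure]_(s in `[n%:R * k, n.+1%:R * k])
         \sum_(a < d) partial a (fun y => \sum_(z < Q)
            c z 0 a * kinetic_entropy (Omega z) (F z s y) : R) x
     = \sum_(z < Q) kinetic_entropy (Omega z) (f n z x)).
Proof.
have t01 : n%:R * k < n.+1%:R * k by rewrite ltr_pM2r // ltr_nat.
have balance x := entropy_transport_balance Omega x t01
  (fun z l => cont_diff_projection_step_coord Omega omega z l f_C1) F_transport.
have step x : exists v : 'I_Q -> 'cV[R]_L, let q := \sum_y Omega y *m v y in
    \sum_(z < Q) kinetic_entropy (Omega z) (f n z x) =
      \sum_(z < Q) kinetic_entropy (Omega z) (Omega z *m v z) /\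
    \sum_(z < Q) kinetic_entropy (Omega z)
        (projection_step Omega omega (f n) z x) =
      (omega ^+ 2 + 2 * omega * (1 - omega)) * (1 / 2 * (q^T *m q) 0 0)
      + (1 - omega) ^+ 2
        * \sum_(z < Q) kinetic_entropy (Omega z) (Omega z *m v z).
  have [v fv] := entropy_domain_range x f_domain; exists v => q; split.
    by apply: eq_bigr => z _; rewrite fv.
  (* Here [a = omega] and [b = 1 - omega]: the projected state is [Omega z] applied to
     [omega *: q + (1 - omega) *: v z]. *)
  rewrite -sum_kinetic_entropy_comb //; apply: eq_bigr => z _.
  rewrite /projection_step fv (eq_bigr _ (fun y _ => fv y)).
  by rewrite mulmxDr -!scalemxAr addrC.
split=> omegaE x; rewrite balance; have [v [-> ->]] := step x; rewrite omegaE.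
  (* For [omega = 1] the coefficients are 1 and 0: only the equilibrium entropy remains, which is
     minimal for the given moment [q]. *)
  rewrite subrr mulr0 addr0 !expr1n mul1r expr0n mul0r addr0.
  exact: sum_kinetic_entropy_ge.
(* For [omega = 2] the coefficients are [4 - 4 = 0] and [(-1)^2 = 1]: the projection reflects the
   state about equilibrium and keeps its entropy. *)
by ring.
Qed.
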